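(* Let $d\ge2$ be an integer, $c,R>0$ and $\beta\in\mathbb R$. The function $$\bar f_\beta(\underline{\mathbf x}_d,t)=\left(c^2t^2-\frac{R^4}{\|\underline{\mathbf x}_d\|^2}\right)^\beta,\qquad \frac{R^2}{ct}<\|\underline{\mathbf x}_d\|\le R,$$ solves the Euler-Poisson-Darboux type partial differential equation with variable coefficients $$\frac{\partial^2u}{\partial t^2}-\frac{a_\beta(\underline{\mathbf x}_d)}{t}\frac{\partial u}{\partial t}=c^2\Delta u,$$ where $$a_\beta(\underline{\mathbf x}_d)=2\beta-1+\frac{R^4}{\|\underline{\mathbf x}_d\|^2}\left[\frac{4-d}{\|\underline{\mathbf x}_d\|^2}+2(\beta-1)\left(\frac{1-R^4/\|\underline{\mathbf x}_d\|^4}{c^2t^2-R^4/\|\underline{\mathbf x}_d\|^2}\right)\right].$$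
   Context: $\underline{\mathbf x}_d=(x_1,\dots,x_d)\in\mathbb R^d$, $t>0$, $\|\cdot\|$ is the Euclidean norm and $\Delta=\sum_{k=1}^d\frac{\partial^2}{\partial x_k^2}$ is the Laplacian in the space variables. The coefficient $a_\beta$ depends on both $\underline{\mathbf x}_d$ and $t$, although only $\underline{\mathbf x}_d$ is displayed in its notation. *)

(* Defs.v *)
From HB Require Import structures.
From mathcomp Require Import all_boot all_order all_algebra.
From mathcomp Require Import all_classical all_reals all_analysis.

Set Implicit Arguments.
Unset Strict Implicit.
Unset Printing Implicit Defensive.

Import Order.TTheory GRing.Theory Num.Theory.
Import numFieldNormedType.Exports.

Local Open Scope classical_set_scope.
Local Open Scope ring_scope.

(* The library's norm on row vectors is the sup norm, which induces the same
   topology but is not the Euclidean norm. *)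
Definition enorm (K : realType) (d : nat) (x : 'rV[K]_d) : K :=
  Num.sqrt (\sum_(k < d) x ord0 k ^+ 2).

(* 'D_v is a total operator, so the existence of the first derivative around x
   has to be required for the iterated operator to be meaningful. *)
Definition twice_derivable (K : realType) (V : normedModType K)
    (f : V -> K) (x v : V) : Prop :=
  (\forall y \near x, derivable f y v) /\ derivable ('D_v f) x v.

Definition laplacian (K : realType) (d : nat) (f : 'rV[K]_d -> K)
    (x : 'rV[K]_d) : K :=
  \sum_(k < d) 'D_(delta_mx ord0 k) ('D_(delta_mx ord0 k) f) x.

(* u is a pointwise solution on D of
     u_tt - (a / t) u_t = c^2 Delta u.
   D need not be open: at a boundary point the derivatives are those of u as a
   function on the whole space. *)
Definition solves_EPD (K : realType) (d : nat) (c : K)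
    (a : 'rV[K]_d -> K -> K) (D : set ('rV[K]_d * K))
    (u : 'rV[K]_d -> K -> K) : Prop :=
  forall (x : 'rV[K]_d) (t : K), D (x, t) ->
    [/\ twice_derivable (u x : K^o -> K) t 1,
        forall k : 'I_d, twice_derivable (u^~ t) x (delta_mx ord0 k) &
        (u x)^`(2)%classic t - a x t / t * (u x)^`()%classic t
          = c ^+ 2 * laplacian (u^~ t) x].

(* Total extension of the closed formula; the base of the real power is positive
   on fbar_domain, where enorm x != 0 as well. *)
Definition fbar (K : realType) (d : nat) (c R beta : K)
    (x : 'rV[K]_d) (t : K) : K :=
  (c ^+ 2 * t ^+ 2 - R ^+ 4 / enorm x ^+ 2) `^ beta.

Definition fbar_domain (K : realType) (d : nat) (c R : K) :
    set ('rV[K]_d * K) :=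
  [set p | 0 < p.2 /\ R ^+ 2 / (c * p.2) < enorm p.1 <= R].

Definition a_coef (K : realType) (d : nat) (c R beta : K)
    (x : 'rV[K]_d) (t : K) : K :=
  2 * beta - 1
  + R ^+ 4 / enorm x ^+ 2
    * ((4 - d%:R) / enorm x ^+ 2
       + 2 * (beta - 1)
         * ((1 - R ^+ 4 / enorm x ^+ 4)
            / (c ^+ 2 * t ^+ 2 - R ^+ 4 / enorm x ^+ 2))).

(* Main.v *)
Require Import Defs.
From mathcomp Require Import all_boot all_order all_algebra.
From mathcomp Require Import all_classical all_reals all_analysis.
From mathcomp Require Import ring.

(** Write u = B^beta with B(x,t) = c^2 t^2 - R^4 / q(x) and q = |x|^2 > 0. The
    directional chain rule gives
      D_v D_v u = beta B^(beta-1) (D_v D_v B + (beta-1) (D_v B)^2 / B)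
    whenever B > 0, both for v the time direction and for v = e_k. Here
    d_k B = 2 R^4 x_k / q^2, so Delta B = 2 R^4 (d - 4) / q^2 and
    |grad B|^2 = 4 R^8 / q^3; replacing c^2 t^2 by B + R^4 / q turns the
    equation into a rational identity that determines a_beta. *)

Import Order.TTheory GRing.Theory Num.Theory.
Import numFieldNormedType.Exports.
Local Open Scope classical_set_scope.
Local Open Scope ring_scope.

Section DirectionalDerivative.
Set Implicit Arguments.
Unset Strict Implicit.
Context {K : realType} {V : normedModType K}.
Implicit Types (f : V -> K) (x v : V).

(** Restricting to the line through [x] in direction [v] leaves the difference quotient unchanged.
    This brings the one-variable differentiation rules to directional derivatives, with no total
    differentiability of [f]. *)
Lemma is_derive_lineP f x v (df : K) :
  is_derive x v f df <-> is_derive (0 : K) 1 (fun h : K => f (h *: v + x)) df.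
Proof.
have E : 'D_v f x = 'D_1 (fun h : K => f (h *: v + x)) 0.
  rewrite /derive; set g1 := fun h => h^-1 *: _; set g2 := fun h => h^-1 *: _.
  suff -> : g1 = g2 by [].
  apply/funext => h; rewrite /g1 /g2 /=.
  by rewrite addr0 scale0r add0r [_%:A]mulr1.
have [h1 h2] := derivable1P f x v.
by split=> -[fd <-]; split; auto; rewrite E.
Qed.

Lemma is_derive_comp1 (g : K -> K) f x v (df dg : K) :
  is_derive x v f df -> is_derive (f x) 1 g dg ->
  is_derive x v (g \o f) (dg * df).
Proof.
move=> /is_derive_lineP fl gd; apply/is_derive_lineP.
apply: (@is_derive1_comp _ g (fun h : K => f (h *: v + x))).
by rewrite /= scale0r add0r.
Qed.

Lemma is_derive_inv f x v (df : K) : f x != 0 ->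
  is_derive x v f df -> is_derive x v (fun y => (f y)^-1) (- (f x) ^- 2 * df).
Proof. by move=> fx0 [fd <-]; split; [exact: derivableV|rewrite deriveV]. Qed.

(** Time and space derivatives are both instances of this. [B] and its derivative [b] are controlled
    near [x], not just at [x], because differentiating ['D_v u] at [x] requires its values
    nearby. *)
Lemma twice_derivable_powR (B b : V -> K) (b' beta : K) x v :
  (\forall y \near x, 0 < B y) ->
  (\forall y \near x, is_derive y v B (b y)) ->
  is_derive x v b b' ->
  let u := fun y => B y `^ beta in
  [/\ twice_derivable u x v,
      'D_v u x = beta * B x `^ (beta - 1) * b x &
      'D_v ('D_v u) x = beta * B x `^ (beta - 1)
        * (b' + (beta - 1) * b x ^+ 2 / B x)].
Proof.
move=> B0 Bb bb' u.
have u1 : \forall y \near x, is_derive y v u (beta * B y `^ (beta - 1) * b y).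
  near=> y; apply: (@is_derive_comp1 (@powR K ^~ beta)).
    by near: y.
  by apply: is_derive1_powR; near: y.
have Bx := nbhs_singleton B0; have Bbx := nbhs_singleton Bb.
have u1E : \forall y \near x, beta * B y `^ (beta - 1) * b y = 'D_v u y.
  by apply: filterS u1 => y [].
have u2 : is_derive x v ('D_v u) (beta * B x `^ (beta - 1)
        * (b' + (beta - 1) * b x ^+ 2 / B x)).
  (* Near [x], ['D_v u] coincides with its closed formula, so it suffices to differentiate that
     product. *)
  apply: near_eq_is_derive u1E _.
  have p := is_derive_comp1 Bbx (is_derive1_powR (beta - 1) Bx).
  have m := is_deriveM (is_deriveZ beta p) bb'.
  apply: (is_derive_eq m).
  have -> : B x `^ (beta - 1 - 1) = B x `^ (beta - 1) / B x.
    by rewrite powRB ?(lt0r_neq0 Bx) ?implybT// powRr1// ltW.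
  by rewrite /= /GRing.scale /=; ring.
split; first split.
- by apply: filterS u1 => y [].
- by case: u2.
- by rewrite -(nbhs_singleton u1E).
- by case: u2.
Unshelve. all: by end_near. Qed.

End DirectionalDerivative.

Section EuclideanNorm.
Set Implicit Arguments.
Unset Strict Implicit.
Context {K : realType} {d : nat}.
Implicit Types x : 'rV[K]_d.

(** The square of [enorm], written as a polynomial so that no square root has to be
    differentiated. *)
Definition sqnorm x : K := \sum_(k < d) x ord0 k ^+ 2.

Lemma enorm_sqr x : enorm x ^+ 2 = sqnorm x.
Proof. by rewrite sqr_sqrtr// sumr_ge0// => k _; exact: sqr_ge0. Qed.

Lemma is_derive_coord x (i k : 'I_d) :
  is_derive x (delta_mx ord0 k : 'rV[K]_d) (fun y : 'rV[K]_d => y ord0 i : K)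
    (i == k)%:R.
Proof.
apply/is_derive_lineP.
have -> : (fun h : K => (h *: (delta_mx ord0 k : 'rV[K]_d) + x) ord0 i) =
    ((i == k)%:R \*: (@id K)) + cst (x ord0 i).
  by apply/funext => h; rewrite !mxE eqxx /= mulrC.
apply: is_derive_eq.
by rewrite addr0 [LHS]mulr1.
Qed.

Lemma is_derive_sqnorm x (k : 'I_d) :
  is_derive x (delta_mx ord0 k : 'rV[K]_d) sqnorm (2 * x ord0 k).
Proof.
have -> : sqnorm = \sum_(i < d) ((fun y : 'rV[K]_d => y ord0 i) ^+ 2).
  by apply/funext => y; rewrite fct_sumE; apply: eq_bigr.
have h i := is_deriveX 2 (is_derive_coord x i k).
apply: (is_derive_eq (is_derive_sum h)).
rewrite (bigD1 k)//= big1 ?addr0 => [|i /negPf ->]; last exact: scaler0.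
by rewrite eqxx expr1 [LHS]mulr1.
Qed.

Lemma continuous_sqnorm : continuous sqnorm.
Proof.
move=> x; apply: (@cvg_big _ _ _ _ _ _ _ (nbhs x)) => [|i _].
  exact: add_continuous.
apply: (cvg_comp _ (fun y : K => y ^+ 2) (@coord_continuous _ _ _ ord0 i x)).
exact: exprn_continuous.
Qed.

End EuclideanNorm.

Section Base.
Set Implicit Arguments.
Unset Strict Implicit.
Context {K : realType} {d : nat}.
Variables c R beta : K.
Implicit Types (x : 'rV[K]_d) (t : K).

Definition fbar_base x t : K := c ^+ 2 * t ^+ 2 - R ^+ 4 / sqnorm x.

Lemma fbarE x t : fbar c R beta x t = fbar_base x t `^ beta.
Proof. by rewrite /fbar enorm_sqr. Qed.

(** Squaring R^2 < c t |x| gives R^4 < c^2 t^2 q. Both conclusions are open conditions, so the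
    derivatives make sense on the boundary sphere |x| = R as well. *)
Lemma fbar_domain_gt0 x t : 0 < c -> fbar_domain c R (x, t) ->
  0 < sqnorm x /\ 0 < fbar_base x t.
Proof.
move=> c0 [/= t0 /andP[xR _]].
have ct0 : 0 < c * t by rewrite mulr_gt0.
have x0 : 0 < enorm x.
  by apply: le_lt_trans xR; rewrite divr_ge0 ?sqr_ge0// ltW.
have q0 : 0 < sqnorm x by rewrite -enorm_sqr exprn_gt0.
split=> //; rewrite subr_gt0 ltr_pdivrMr// -enorm_sqr -!exprMn.
have -> : R ^+ 4 = (R ^+ 2) ^+ 2 by rewrite -exprM.
rewrite ltr_pXn2r// ?nnegrE ?sqr_ge0// ?mulr_ge0 ?(ltW c0) ?(ltW t0) ?sqrtr_ge0//.
by move: xR; rewrite ltr_pdivrMr// mulrC.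
Qed.

Lemma fbar_derive_time x t : 0 < fbar_base x t ->
  [/\ twice_derivable (fbar c R beta x : K^o -> K) t 1,
      (fbar c R beta x)^`()%classic t
        = beta * fbar_base x t `^ (beta - 1) * (2 * c ^+ 2 * t) &
      (fbar c R beta x)^`(2)%classic t
        = beta * fbar_base x t `^ (beta - 1)
          * (2 * c ^+ 2
             + (beta - 1) * (2 * c ^+ 2 * t) ^+ 2 / fbar_base x t)].
Proof.
move=> B0.
have -> : fbar c R beta x = (fun s => fbar_base x s `^ beta).
  by apply/funext => s; exact: fbarE.
have dB (s : K) : is_derive s 1 (fbar_base x) (2 * c ^+ 2 * s).
  have -> : fbar_base x =
    c ^+ 2 \*: (@id K) ^+ 2 - cst (R ^+ 4 / sqnorm x) by [].
  by apply: is_derive_eq; rewrite /= /GRing.scale /=; ring.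
have ddB : is_derive t 1 (fun s : K => 2 * c ^+ 2 * s) (2 * c ^+ 2).
  have -> : (fun s => 2 * c ^+ 2 * s) = (2 * c ^+ 2) \*: (@id K) by [].
  by apply: is_derive_eq; exact: mulr1.
have Bnear : \forall s \near t, 0 < fbar_base x s.
  have : {for t, continuous (fbar_base x)}.
    by apply: cvgB; [apply: cvgMr; exact: exprn_continuous|exact: cvg_cst].
  by move=> /cvgr_gt; exact.
have dBnear : \forall s \near t, is_derive (s : K) 1 (fbar_base x) (2 * c ^+ 2 * s).
  exact: filterE.
have E (u : K -> K) : u^`()%classic = 'D_1 u.
  by apply/funext => s; rewrite derive1E.
rewrite /derive1n /= !E.
exact: (@twice_derivable_powR K K^o _ _ _ beta t 1 Bnear dBnear ddB).
Qed.

(** The factor after 2 R^4 comes from differentiating x_k q^-2 along e_k. Keeping powers of q^-1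
    reduces the checks to polynomial identities in q^-1. *)
Lemma fbar_derive_space x t (k : 'I_d) (e := delta_mx ord0 k : 'rV[K]_d) :
  0 < sqnorm x -> 0 < fbar_base x t ->
  twice_derivable ((fbar c R beta)^~ t) x e /\
  'D_e ('D_e ((fbar c R beta)^~ t)) x
    = beta * fbar_base x t `^ (beta - 1)
      * (2 * R ^+ 4
         * ((sqnorm x)^-1 ^+ 2 - 4 * x ord0 k ^+ 2 * (sqnorm x)^-1 ^+ 3)
         + (beta - 1) * (2 * R ^+ 4 * x ord0 k * (sqnorm x)^-1 ^+ 2) ^+ 2
           / fbar_base x t).
Proof.
move=> q0 B0.
have -> : (fbar c R beta)^~ t = (fun y : 'rV[K]_d => fbar_base y t `^ beta).
  by apply/funext => y; exact: fbarE.
have dV (y : 'rV[K]_d) : 0 < sqnorm y ->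
    is_derive y e (fun y => (sqnorm y)^-1) (- (sqnorm y) ^- 2 * (2 * y ord0 k)).
  move=> qy; apply: is_derive_inv; first by rewrite gt_eqF.
  exact: is_derive_sqnorm.
pose b (y : 'rV[K]_d) : K := 2 * R ^+ 4 * y ord0 k * (sqnorm y)^-1 ^+ 2.
have dB : \forall y \near x, is_derive y e (fbar_base^~ t) (b y).
  have qnear : \forall y \near x, 0 < sqnorm y.
    by move: (@continuous_sqnorm K d x) => /cvgr_gt; exact.
  apply: filterS qnear => y qy; have h := dV _ qy.
  have -> : fbar_base^~ t =
    cst (c ^+ 2 * t ^+ 2)
    - (R ^+ 4 \*: (fun y : 'rV[K]_d => (sqnorm y)^-1)) by [].
  apply: is_derive_eq; rewrite /b /= /GRing.scale /= -exprVn; ring.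
have ddB : is_derive x e b (2 * R ^+ 4
    * ((sqnorm x)^-1 ^+ 2 - 4 * x ord0 k ^+ 2 * (sqnorm x)^-1 ^+ 3)).
  have -> : b = ((2 * R ^+ 4) \*: (fun y : 'rV[K]_d => y ord0 k))
      * (fun y => (sqnorm y)^-1) ^+ 2 by [].
  have h := dV _ q0; have h' := is_derive_coord x k k.
  apply: is_derive_eq; rewrite exprfctE /= /GRing.scale /= eqxx mulr1 -exprVn; ring.
have Bnear : \forall y \near x, 0 < fbar_base y t.
  have : {for x, continuous (fbar_base^~ t)}.
    apply: (@cvgB _ _ _ (nbhs x)); first exact: (@cvg_cst _ _ _ (nbhs x)).
    apply: (@cvgMr _ _ (nbhs x)); apply: (@cvgV _ _ (nbhs x)).
      by rewrite gt_eqF.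
    exact: continuous_sqnorm.
  by move=> /cvgr_gt; exact.
by have [? _ ?] := twice_derivable_powR beta Bnear dB ddB.
Qed.

Lemma laplacian_fbar x t : 0 < sqnorm x -> 0 < fbar_base x t ->
  laplacian ((fbar c R beta)^~ t) x
    = beta * fbar_base x t `^ (beta - 1)
      * (2 * R ^+ 4 * (d%:R - 4) / sqnorm x ^+ 2
         + 4 * (beta - 1) * R ^+ 8 / (sqnorm x ^+ 3 * fbar_base x t)).
Proof.
move=> q0 B0; rewrite /laplacian.
under eq_bigr => k _ do rewrite (fbar_derive_space k q0 B0).2.
rewrite -mulr_sumr; congr (_ * _).
set q := sqnorm x in q0 *; set B := fbar_base x t in B0 *.
(* Each summand is affine in x_k^2: the constant part is counted d times, and the squares sum to q,
   which lowers the power of q^-1 by one. *)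
transitivity (\sum_(k < d) (2 * R ^+ 4 * q^-1 ^+ 2
    + (4 * (beta - 1) * R ^+ 8 * q^-1 ^+ 4 / B - 8 * R ^+ 4 * q^-1 ^+ 3)
      * x ord0 k ^+ 2)).
  by apply: eq_bigr => k _; ring.
rewrite big_split /= sumr_const card_ord -mulr_sumr -/(sqnorm x) -/q.
rewrite -[_ *+ d]mulr_natr.
by field; rewrite !gt_eqF.
Qed.

End Base.

Theorem mainTheorem5 (K : realType) (d : nat) (c R beta : K)
    (hd : (2 <= d)%N) (hc : 0 < c) (hR : 0 < R) :
  solves_EPD c (a_coef c R beta) (@fbar_domain K d c R) (fbar c R beta).
Proof.
move=> x t D; have [q0 B0] := fbar_domain_gt0 hc D; have t0 : 0 < t by case: D.
have [T1 T2 T3] := fbar_derive_time beta B0.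
split; first exact: T1.
  by move=> k; have [] := fbar_derive_space beta k q0 B0.
rewrite (laplacian_fbar beta q0 B0) T2 T3 /a_coef enorm_sqr.
have -> : enorm x ^+ 4 = sqnorm x ^+ 2 by rewrite -enorm_sqr -exprM.
rewrite -/(fbar_base c R x t).
(* The real power is a common factor of all terms; once it is opaque, only a rational identity
   remains. *)
set A := _ `^ _; set q := sqnorm x in q0 *.
have E : c ^+ 2 * t ^+ 2 = fbar_base c R x t + R ^+ 4 / q.
  by rewrite /fbar_base subrK.
set B := fbar_base _ _ _ _ in B0 E *.
(* Eliminating c^2 t^2 removes the dependence between [B], [t] and q, so that [field] can treat them
   as independent atoms. *)
have -> : (2 * c ^+ 2 * t) ^+ 2 = 4 * c ^+ 2 * (B + R ^+ 4 / q).
  by rewrite -E; ring.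
by field; rewrite !gt_eqF.
Qed.
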